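(* Let $A(x)=\sum_{i=0}^n A_ix^i\in\mathcal P_{m,n}$ and $a(x)=\det A(x)$. For $\kappa\in\{0,\dots,n\}$ with $\det A_\kappa\neq 0$ consider the equation $$x^\kappa=\sum_{i=0,\,i\ne\kappa}^n\|A_\kappa^{-1}A_i\|\,x^i.\qquad(\ast_\kappa)$$ \begin{enumerate} \item If $0<\kappa<n$ is such that $\det A_\kappa\ne 0$, then $(\ast_\kappa)$ has either no real positive solution or two real positive solutions $s_\kappa\le t_\kappa$. \item In the latter case, the polynomial $a(x)$ has no roots in the inner part of the annulus $\mathcal A(s_\kappa,t_\kappa)$, while it has $m\kappa$ roots of modulus less than or equal to $s_\kappa$. \item If $\kappa=0$ and $\det A_0\ne 0$, then $(\ast_0)$ has only one real positive root $t_0$; moreover, $a(x)$ has no root of modulus less than $t_0$. \item If $\kappa=n$ and $\det A_n\ne 0$, then $(\ast_n)$ has only one real positive solution $s_n$, and $a(x)$ has no roots of modulus greater than $s_n$. \end{enumerate}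
   Context: $\mathcal P_{m,n}$ is the class of matrix polynomials $A(x)=\sum_{i=0}^nA_ix^i$ with $A_i\in\mathbb C^{m\times m}$ such that $\det A(x)$ is not identically zero, $A_n\ne0$ and $A_0\neq 0$. $\|M\|=\rho(M^*M)^{1/2}$ is the spectral (2-)norm. $\mathcal A(a,b)=\{x\in\mathbb C: a\le|x|\le b\}$; its inner part is $\{x: a<|x|<b\}$. Roots of $a(x)$ and solutions of the scalar equation are counted with multiplicity (so $s_\kappa=t_\kappa$ denotes a double solution).
   Formalization: The count of mκ roots of modulus at most s_κ is proved exactly when s_κ < t_κ, and as ''at least mκ'' when s_κ = t_κ (x²−2x+1 with κ=1 has two such roots, not one); n ≥ 1 is assumed, since for n = 0 the equation reads 1 = 0. *)

(* Defs.v *)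
From mathcomp Require Import all_boot all_order all_algebra all_reals.
From mathcomp Require Import complex.

Set Implicit Arguments.
Unset Strict Implicit.
Unset Printing Implicit Defensive.

Import Order.TTheory GRing.Theory Num.Theory.
Import Normc.

Local Open Scope ring_scope.
Local Open Scope complex_scope.
Local Open Scope sesquilinear_scope.

Section Definitions.
Variable R : realType.

Definition complex_roots (p : {poly R[i]}) : seq R[i] :=
  sval (closed_field_poly_normal p).

Lemma complex_rootsP (p : {poly R[i]}) :
  p = lead_coef p *: \prod_(z <- complex_roots p) ('X - z%:P).
Proof. exact: svalP (closed_field_poly_normal p). Qed.

Lemma mem_complex_roots (p : {poly R[i]}) (z : R[i]) :
  p != 0 -> (z \in complex_roots p) = root p z.
Proof.
move=> p0; rewrite [in RHS](complex_rootsP p) rootZ ?lead_coef_eq0//.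
by rewrite root_prod_XsubC.
Qed.

(* The norm [`|z|] of [z : R[i]] is itself in [R[i]]; [normc z] is the same
   modulus as an element of [R]. *)
Definition spectral_radius (m : nat) (M : 'M[R[i]]_m) : R :=
  \big[Num.max/0]_(z <- complex_roots (char_poly M)) normc z.

Definition spectral_norm (m : nat) (M : 'M[R[i]]_m) : R :=
  Num.sqrt (spectral_radius (M ^t* *m M)).

Section MatrixPolynomials.
Variables m n : nat.
Implicit Types (A : 'I_n.+1 -> 'M[R[i]]_m) (k : 'I_n.+1).

Definition matrix_poly A : 'M[{poly R[i]}]_m :=
  \sum_(i < n.+1) 'X^i *: map_mx polyC (A i).

Definition det_poly A : {poly R[i]} := \det (matrix_poly A).

Definition matrix_poly_class A : Prop :=
  [/\ det_poly A != 0, A ord_max != 0 & A ord0 != 0].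

Definition pellet_coef A k (i : 'I_n.+1) : R :=
  spectral_norm (invmx (A k) *m A i).

(* The two sides of the scalar equation are subtracted, so that solutions can
   be counted with multiplicity. *)
Definition pellet_poly A k : {poly R} :=
  'X^k - \sum_(i < n.+1 | i != k) pellet_coef A k i *: 'X^i.

Lemma root_pellet_poly A k (x : R) :
  root (pellet_poly A k) x =
  (x ^+ k == \sum_(i < n.+1 | i != k) pellet_coef A k i * x ^+ i).
Proof.
rewrite /root hornerD hornerN hornerXn horner_sum subr_eq0.
by congr (_ == _); apply: eq_bigr => i _; rewrite hornerZ hornerXn.
Qed.

End MatrixPolynomials.

(* [s] lists, up to order, the positive roots of [q] repeated according to
   their multiplicities; [s = [::]] means that there is none. *)
Definition positive_roots (q : {poly R}) (s : seq R) : Prop :=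
  {in s, forall x, 0 < x} /\ (forall x : R, 0 < x -> count_mem x s = mup x q).

Definition count_roots_le (p : {poly R[i]}) (r : R) : nat :=
  count (fun z => normc z <= r) (complex_roots p).

End Definitions.

(* Main.v *)
Require Import Defs.
From mathcomp Require Import all_boot all_order all_algebra all_reals.
From mathcomp Require Import complex.
From mathcomp Require Import polyrcf ring lra.
Import Order.TTheory GRing.Theory Num.Theory.
Import Normc.
Local Open Scope ring_scope.
Local Open Scope complex_scope.

(** For a fixed [k] write [c_i] for the norm of [A_k^-1 A_i] and
    [q(x) = x^k - \sum_(i != k) c_i x^i], so that the scalar equation is
    [q(x) = 0].

    The positive roots of [q] are found by removing them one at a time
    ([two_sign_changes], [one_sign_change]): dividing a polynomial by [X - s],
    for a positive root [s], removes one sign change from its coefficients, and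
    a polynomial with exactly one sign change has exactly one positive root,
    which is simple.  So [q] has no positive root or is
    [(X - s)(t - X) r(X)] with [r > 0] on the positive axis; in particular
    [q > 0] strictly between [s] and [t].  When [k] is [0] or [n] a single
    factor [t - X] or [X - t] comes out.

    Where [q(|z|) > 0], the term [z^k A_k] dominates the others, and [A(z) u = 0]
    forces [u = 0] ([det_dominant_ne0]); the estimate uses that the spectral norm
    bounds the l2 operator norm, by unitary diagonalisation of [M^* M]
    ([dotmx_mulmx_tr]).  The same holds for
    [A_k x^k + tau \sum_(i != k) A_i x^i] with [tau] in [0, 1], which joins
    [A_k x^k], whose determinant has [m k] roots at [0], to [A(x)].

    The root count in a disc is constant along a polynomial homotopy [p_tau]
    without roots in an annulus [r1 < |z| < r2]
    ([count_roots_le_homotopy]).  The proof is a discrete Jensen formula.  If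
    [J_c(p)] is the product of the [|p(y)|] over the [y] with [y^N = c], then
    [J_c(p) = |lead_coef p|^N \prod_z |z^N - c|] over the roots [z] of [p].
    With [U = r1^N] and [x] large, but [U x^3 <= r2^N], the ratio
    [J_(U x^2)(p) / J_(U x)(p)] is within a factor that does not depend on [x]
    of [x^(number of roots in the disc)].  A jump in that number would
    make the ratio cross a level that it cannot take; since [J_c(p_tau)^2] is a
    real polynomial in [tau], the intermediate value theorem forbids it.

    If [s < t], this applies on the annulus between [s] and [t].  If [s = t], it
    gives [m k] roots in the closed disc for each [tau < 1], and these roots stay
    in the closed disc as [tau] tends to [1] ([count_roots_le_limit]). *)

(** * Positive roots of real polynomials with few sign changes *)

Section SignChanges.
Set Implicit Arguments.
Unset Strict Implicit.
Variable R : realType.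
Implicit Types (p q r : {poly R}) (s t x : R).

Lemma root_XsubC_factor p t : root p t -> exists r, p = ('X - t%:P) * r.
Proof. by case/factor_theorem=> r ->; exists r; rewrite mulrC. Qed.

Lemma coef_XsubCM_0 r t : (('X - t%:P) * r)`_0 = - t * r`_0.
Proof. by rewrite mulrBl coefB coefXM coefCM sub0r mulNr. Qed.

Lemma coef_XsubCM_S r t j :
  (('X - t%:P) * r)`_j.+1 = r`_j - t * r`_j.+1.
Proof. by rewrite mulrBl coefB coefXM coefCM. Qed.

Lemma downward_induction (P : nat -> Prop) (k N : nat) :
  (forall j, (N <= j)%N -> P j) ->
  (forall j, (k <= j)%N -> P j.+1 -> P j) ->
  forall j, (k <= j)%N -> P j.
Proof.
move=> PN IH j kj; have [/PN//|] := leqP N j.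
move=> /ltnW jN; move: (erefl (N - j)%N).
move: {1}(N - j)%N => d eqd; elim: d j kj jN eqd => [|d IHd] j kj jN eqd.
  by apply: PN; rewrite -subn_eq0 -eqd.
apply: IH => //; have ltjN : (j < N)%N by rewrite -subn_gt0 -eqd.
by apply: IHd => //; [exact: leqW | rewrite subnS -eqd].
Qed.

Lemma horner_gt0_of_coef_ge0 p x :
  0 < x -> (forall i, 0 <= p`_i) -> 0 < p`_0 -> 0 < p.[x].
Proof.
move=> x0 p_ge0 p0_gt0.
have szp : (0 < size p)%N.
  by rewrite size_poly_gt0; apply: contraTneq p0_gt0 => ->; rewrite coef0 ltxx.
rewrite horner_coef; move: szp; case: (size p) => // n _.
rewrite big_ord_recl expr0 mulr1 ltr_pwDl// sumr_ge0// => i _.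
by rewrite mulr_ge0// exprn_ge0// ltW.
Qed.

(** A polynomial whose coefficients change sign once has a single positive root,
    which is simple: the cofactor has nonnegative coefficients. *)
Lemma one_sign_change p k :
    (forall i, (i < k)%N -> 0 <= p`_i) -> (forall i, (k <= i)%N -> p`_i <= 0) ->
    0 < p`_0 -> (exists j, p`_j < 0) ->
  exists t r, [/\ 0 < t, p = (t%:P - 'X) * r & forall x, 0 < x -> 0 < r.[x]].
Proof.
move=> p_lo p_hi p0 [j pj].
(* The coefficients of degree at least [k] are nonpositive and one is not zero,
   so the leading coefficient is negative and [p] changes sign on the axis. *)
have kj : (k <= j)%N.
  by rewrite leqNgt; apply/negP => /p_lo; rewrite leNgt pj.
have szp : (j < size p)%N.
  by rewrite ltnNge; apply/negP => /leq_sizeP/(_ j (leqnn _)) pj0; lra.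
have lc_lt0 : lead_coef p < 0.
  rewrite lt_neqAle lead_coef_eq0 -size_poly_gt0 (leq_ltn_trans _ szp)//=.
  by apply: p_hi; rewrite (leq_trans kj)// -ltnS prednK// (leq_ltn_trans _ szp).
have [y yP] : exists y, forall x, y <= x -> p.[x] < 0.
  have [|y yP] := @poly_pinfty_gt_lc _ (- p).
    by rewrite lead_coefN oppr_gt0.
  exists y => x /yP; rewrite hornerN lead_coefN; lra.
have ymax : y <= Num.max y 0 by rewrite le_max lexx.
have [] := @poly_ivtoo _ p 0 (Num.max y 0).
- by rewrite le_max lexx orbT.
- by rewrite horner_coef0 pmulr_rlt0// yP.
move=> t; rewrite in_itv /= => /andP[t0 _] /root_XsubC_factor[r pE].
(* The nonnegativity of the coefficients of [u] is obtained from the constant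
   term upwards below degree [k], and from the top downwards above it. *)
pose u := - r; have pE' : p = (t%:P - 'X) * u by rewrite pE /u mulrN -mulNr opprB.
have p0E : p`_0 = t * u`_0 by rewrite pE coef_XsubCM_0 coefN; lra.
have pSE i : p`_i.+1 = t * u`_i.+1 - u`_i.
  by rewrite pE coef_XsubCM_S !coefN; lra.
have u0 : 0 < u`_0 by move: p0; rewrite p0E pmulr_rgt0.
have u_hi : forall i, (k <= i.+1)%N -> 0 <= u`_i.
  move=> i ki; have : (k.-1 <= i)%N by case: (k) ki.
  apply: (@downward_induction (fun i => 0 <= u`_i) k.-1 (size u)).
    by move=> l lu; rewrite nth_default.
  move=> l kl ul; have := p_hi l.+1; rewrite pSE.
  have -> : (k <= l.+1)%N by case: (k) kl.
  move/(_ isT); have := mulr_ge0 (ltW t0) ul; lra.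
have u_ge0 : forall i, 0 <= u`_i.
  elim=> [|i ui]; first exact: ltW.
  have [ki|ki] := leqP k i.+1; first by apply: u_hi; rewrite leqW.
  have := p_lo _ ki; rewrite pSE => h.
  by rewrite -(pmulr_rge0 _ t0); lra.
by exists t, u; split=> // x x0; apply: horner_gt0_of_coef_ge0.
Qed.

(** With the sign pattern - + -, the quotient by [X - s] at a positive root [s]
    has a single sign change, so that exactly one more positive root splits off. *)
Lemma two_sign_changes p k n s :
    (0 < k < n)%N -> (size p <= n.+1)%N ->
    (forall i, i != k -> p`_i <= 0) -> p`_0 < 0 -> p`_n < 0 ->
    0 < s -> root p s ->
  exists t r,
    [/\ 0 < t, p = ('X - s%:P) * (t%:P - 'X) * r & forall x, 0 < x -> 0 < r.[x]].
Proof.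
move=> /andP[k0 kn] szp p_le0 p0 pn s0 /root_XsubC_factor[u pE].
have p0E : p`_0 = - s * u`_0 by rewrite pE coef_XsubCM_0.
have pSE i : p`_i.+1 = u`_i - s * u`_i.+1 by rewrite pE coef_XsubCM_S.
have u0 : 0 < u`_0 by rewrite -(pmulr_rgt0 _ s0); lra.
have u_lo : forall i, (i < k)%N -> 0 <= u`_i.
  elim=> [|i IHi] ik; first exact: ltW.
  have := IHi (ltnW ik); have := p_le0 i.+1; rewrite (ltn_eqF ik) => /(_ isT).
  by rewrite pSE => h1 h2; rewrite -(pmulr_rge0 _ s0); lra.
have u_hi : forall i, (k <= i)%N -> u`_i <= 0.
  apply: (@downward_induction _ k (size u)) => [i ui|i ki ui].
    by rewrite nth_default.
  have := p_le0 i.+1; rewrite (gtn_eqF (_ : k < i.+1)%N)// pSE => /(_ isT).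
  by have := ui; rewrite -(pmulr_rle0 _ s0); lra.
have un : u`_n.-1 < 0.
  have n0 : (0 < n)%N by apply: leq_ltn_trans kn.
  move: pn; rewrite -{1}(prednK n0) pSE (prednK n0).
  by have := u_hi n (ltnW kn); rewrite -(pmulr_rle0 _ s0); lra.
have [|t [r [t0 uE r0]]] := one_sign_change u_lo u_hi u0; first by exists n.-1.
by exists t, r; split=> //; rewrite -mulrA -uE.
Qed.

Lemma mup_CsubX t x : mup x (t%:P - 'X) = (t == x).
Proof.
have -> : t%:P - 'X = (- 1)%:P * ('X - t%:P) by rewrite polyCN mulN1r opprB.
rewrite mupMr; last by rewrite rootC oppr_eq0 oner_eq0.
by have := mup_XsubCX 1 x t; rewrite expr1 => ->; case: eqP.
Qed.

Lemma positive_roots1 p r t :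
    0 < t -> p = (t%:P - 'X) * r -> (forall x, 0 < x -> 0 < r.[x]) ->
  positive_roots p [:: t].
Proof.
move=> t0 -> r0; split=> [x|x x0]; first by rewrite inE => /eqP->.
by rewrite mupMl ?mup_CsubX /= ?addn0// rootE gt_eqF// r0.
Qed.

Lemma positive_roots2 p r s t :
    0 < s -> 0 < t -> p = ('X - s%:P) * (t%:P - 'X) * r ->
    (forall x, 0 < x -> 0 < r.[x]) ->
  positive_roots p [:: s; t].
Proof.
move=> s0 t0 -> r0; split=> [x|x x0].
  by rewrite !inE => /orP[]/eqP->.
rewrite mupMl; last by rewrite rootE gt_eqF// r0.
rewrite mupM ?polyXsubC_eq0//; last by rewrite -opprB oppr_eq0 polyXsubC_eq0.
rewrite mup_CsubX; have := mup_XsubCX 1 x s; rewrite expr1 => -> /=.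
by rewrite addn0; case: eqP.
Qed.

Lemma positive_roots_nil p :
  (forall x, 0 < x -> ~~ root p x) -> positive_roots p [::].
Proof. by move=> rp; split=> // x x0; rewrite mupNroot// rp. Qed.

Lemma positive_roots_root p (l : seq R) x : p != 0 ->
  positive_roots p l -> x \in l -> root p x.
Proof.
move=> p0 [lpos lP] xl; rewrite -dvdp_XsubCl XsubC_dvd// -lP; last exact: lpos.
by rewrite -has_count has_pred1.
Qed.

End SignChanges.

(** * The spectral norm bounds the operator norm *)

Section SpectralNorm.
Set Implicit Arguments.
Unset Strict Implicit.
Variable R : realType.
Local Open Scope sesquilinear_scope.

Lemma real_normc (z : R[i]) : (normc z)%:C = `|z|.
Proof. by []. Qed.

Lemma spectral_radius_ge0 m (M : 'M[R[i]]_m) : 0 <= spectral_radius M.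
Proof.
rewrite /spectral_radius; elim/big_ind: _ => [//|x y x0 y0|z _].
  by rewrite le_max x0.
by rewrite -lecR real_normc normr_ge0.
Qed.

Lemma spectral_radius_ge m (M : 'M[R[i]]_m) z :
  root (char_poly M) z -> normc z <= spectral_radius M.
Proof.
move=> Mz; rewrite /spectral_radius le_bigmax_seq//.
by rewrite mem_complex_roots// monic_neq0// char_poly_monic.
Qed.

(** The rows of the diagonalising matrix are eigenvectors. *)
Lemma root_char_poly_spectral_diag m (H : 'M[R[i]]_m) j :
  H \is normalmx -> root (char_poly H) (spectral_diag H 0 j).
Proof.
move=> /orthomx_spectralP HE; rewrite -eigenvalue_root_char.
set P := spectralmx H in HE.
have Pu : P \in unitmx by apply: spectral_unit.
have PH : P *m H = diag_mx (spectral_diag H) *m P.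
  by rewrite {1}HE !mulmxA mulmxV// mul1mx.
apply/eigenvalueP; exists (row j P).
  by rewrite -row_mul PH row_mul row_diag_mx -scalemxAl -rowE.
apply: contraTneq Pu => Pj0; rewrite unitmxE.
rewrite (expand_det_row _ j) big1 ?unitr0// => l _.
by move/rowP: Pj0 => /(_ l); rewrite !mxE => ->; rewrite mul0r.
Qed.

(** The inequality [|M v|^2 <= rho(M^* M) |v|^2], written for the row vector
    [u = v^*], as [dotmx] is a product of row vectors. *)
Lemma dotmx_mulmx_tr m (M : 'M[R[i]]_m) (u : 'rV[R[i]]_m) :
  dotmx (u *m M ^t*) (u *m M ^t*) <=
  (spectral_radius (M ^t* *m M))%:C * dotmx u u.
Proof.
set H := M ^t* *m M; set P := spectralmx H.
have Pu : P \is unitarymx by apply: spectral_unitarymx.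
have Hn : H \is normalmx.
  by apply/normalmxP; rewrite /H trmx_mul map_mxM trmxCK.
have HE : H = P ^t* *m diag_mx (spectral_diag H) *m P.
  by rewrite -invmx_unitary//; apply/orthomx_spectralP.
pose w := u *m P ^t*.
have wE v : w *m v *m w ^t* = u *m P ^t* *m v *m P *m u ^t*.
  by rewrite /w trmx_mul map_mxM trmxCK !mulmxA.
have -> : dotmx u u = \sum_j `|w 0 j| ^+ 2.
  have -> : dotmx u u = dotmx w w.
    rewrite !dotmxE; have := wE 1%:M; rewrite !mulmx1 => ->.
    by rewrite -[u *m _ *m P]mulmxA -invmx_unitary// mulVmx ?mulmx1 ?unitarymx_unit.
  by rewrite dotmxE mxE; apply: eq_bigr => j _; rewrite !mxE normCK.
rewrite -[leLHS]ger0_norm ?dnorm_ge0//.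
have -> : dotmx (u *m M ^t*) (u *m M ^t*) =
    \sum_j spectral_diag H 0 j * `|w 0 j| ^+ 2.
  rewrite dotmxE trmx_mul map_mxM trmxCK.
  have -> : u *m M ^t* *m (M *m u ^t*) = u *m H *m u ^t* by rewrite /H !mulmxA.
  rewrite [in LHS]HE !mulmxA -wE mxE; apply: eq_bigr => j _.
  by rewrite mul_mx_diag !mxE normCK mulrAC mulrC.
apply: le_trans (ler_norm_sum _ _ _) _.
rewrite mulr_sumr; apply: ler_sum => j _.
rewrite normrM [X in _ * X]ger0_norm ?exprn_ge0// ler_wpM2r ?exprn_ge0//.
by rewrite -real_normc lecR; apply/spectral_radius_ge/root_char_poly_spectral_diag.
Qed.

End SpectralNorm.

(** * Invertibility when one coefficient dominates *)

Section DominantCoefficient.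
Set Implicit Arguments.
Unset Strict Implicit.
Variable R : realType.
Local Open Scope sesquilinear_scope.

(** The l2 norm of a row vector, with its real value seen in [R[i]], where
    [sqrtC] and the triangle inequality for [dotmx] live. *)
Definition l2norm m (u : 'rV[R[i]]_m) : R[i] := sqrtC (dotmx u u).

Lemma l2norm_ge0 m (u : 'rV[R[i]]_m) : 0 <= l2norm u.
Proof. by rewrite sqrtC_ge0 dnorm_ge0. Qed.

Lemma l2norm_gt0 m (u : 'rV[R[i]]_m) : (0 < l2norm u) = (u != 0).
Proof. by rewrite sqrtC_gt0 dnorm_gt0. Qed.

Lemma l2norm0 m : l2norm (0 : 'rV[R[i]]_m) = 0.
Proof. by apply/eqP; rewrite sqrtC_eq0 dnorm_eq0. Qed.

Lemma l2normZ m a (u : 'rV[R[i]]_m) : l2norm (a *: u) = `|a| * l2norm u.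
Proof. by rewrite /l2norm dnormZ sqrtCM ?nnegrE ?exprn_ge0 ?dnorm_ge0// sqrCK. Qed.

Lemma le_l2normD m (u v : 'rV[R[i]]_m) : l2norm (u + v) <= l2norm u + l2norm v.
Proof. exact: triangle_lerif. Qed.

Lemma le_l2norm_sum (I : finType) (P : pred I) m (F : I -> 'rV[R[i]]_m) :
  l2norm (\sum_(i | P i) F i) <= \sum_(i | P i) l2norm (F i).
Proof.
elim/big_ind2: _ => [|u a v b ua vb|//]; first by rewrite l2norm0.
by apply: le_trans (le_l2normD _ _) _; apply: lerD.
Qed.

Lemma spectral_norm_ge0 m (M : 'M[R[i]]_m) : 0 <= spectral_norm M.
Proof. exact: sqrtr_ge0. Qed.

Lemma l2norm_mulmx_tr m (M : 'M[R[i]]_m) (u : 'rV[R[i]]_m) :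
  l2norm (u *m M ^t*) <= (spectral_norm M)%:C * l2norm u.
Proof.
have s0 : 0 <= (spectral_norm M)%:C by rewrite (lecR 0) spectral_norm_ge0.
rewrite -(@ler_pXn2r _ 2)// ?nnegrE ?l2norm_ge0 ?mulr_ge0 ?l2norm_ge0//.
rewrite exprMn !sqrtCK -rmorphXn /spectral_norm sqr_sqrtr ?spectral_radius_ge0//.
exact: dotmx_mulmx_tr.
Qed.

Lemma spectral_norm_eq0 m (M : 'M[R[i]]_m) : spectral_norm M = 0 -> M = 0.
Proof.
move=> M0; suff : M ^t* = 0.
  by move=> h; rewrite -[M]trmxCK h trmx0 map_mx0.
apply/row_matrixP => i; rewrite row0 rowE; apply/eqP.
by rewrite -[_ == 0]negbK -l2norm_gt0 le_gtF// (le_trans (l2norm_mulmx_tr _ _))// M0 mul0r.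
Qed.

Lemma normcX (x : R[i]) i : normc (x ^+ i) = normc x ^+ i.
Proof. by apply: complexI; rewrite real_normc normrX -real_normc rmorphXn. Qed.

Lemma normc_ge0 (x : R[i]) : 0 <= normc x.
Proof. by rewrite -lecR real_normc normr_ge0. Qed.

(** Triangle inequality for a vector [u] in the kernel of the adjoint of
    [A_k^-1] times the matrix: its norm would be less than itself. *)
Lemma det_dominant_ne0 m n (A : 'I_n.+1 -> 'M[R[i]]_m) (k : 'I_n.+1) (tau : R)
    (x : R[i]) :
  \det (A k) != 0 -> 0 <= tau ->
  tau * (\sum_(i < n.+1 | i != k) pellet_coef A k i * normc x ^+ i)
    < normc x ^+ k ->
  \det (x ^+ k *: A k + tau%:C *: \sum_(i < n.+1 | i != k) x ^+ i *: A i) != 0.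
Proof.
move=> Ak t0 dom.
have Aku : A k \in unitmx by rewrite unitmxE unitfE.
pose C := (x ^+ k)%:M + tau%:C *: \sum_(i < n.+1 | i != k) x ^+ i *: (invmx (A k) *m A i).
rewrite (_ : _ + _ = A k *m C); last first.
  rewrite mulmxDr mul_mx_scalar -scalemxAr mulmx_sumr; congr (_ + _ *: _).
  by apply: eq_bigr => i _; rewrite -scalemxAr mulKVmx.
rewrite det_mulmx mulf_neq0//; apply/negP => C0.
have : \det (C ^t*) == 0 by rewrite det_map_mx det_tr conjC_eq0.
case/det0P=> u u0 uC.
have {uC} : (x ^+ k)^* *: u =
    - (tau%:C *: \sum_(i < n.+1 | i != k) (x ^+ i)^* *: (u *m (invmx (A k) *m A i) ^t*)).
  apply/eqP; rewrite -subr_eq0; apply/eqP.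
  rewrite opprK -[RHS]uC /C linearD /= map_mxD mulmxDr tr_scalar_mx map_scalar_mx mul_mx_scalar.
  congr (_ + _).
  rewrite linearZ /= map_mxZ -scalemxAr; congr (_ *: _).
    by rewrite /= conj_Creal// complex_real.
  rewrite linear_sum /= map_mx_sum mulmx_sumr; apply: eq_bigr => i _.
  by rewrite linearZ /= map_mxZ -scalemxAr.
move/(congr1 (@l2norm m)); rewrite l2normZ norm_conjC.
rewrite -scaleNr l2normZ normrN => E.
have : `|tau%:C| * l2norm (\sum_(i < n.+1 | i != k) (x ^+ i)^* *: (u *m (invmx (A k) *m A i) ^t*))
   <= (tau * (\sum_(i < n.+1 | i != k) pellet_coef A k i * normc x ^+ i))%:C * l2norm u.
  rewrite ger0_norm ?(lecR 0)// rmorphM /= -mulrA ler_wpM2l ?(lecR 0)//.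
  apply: le_trans (le_l2norm_sum _ _) _.
  rewrite rmorph_sum /= mulr_suml; apply: ler_sum => i _.
  rewrite l2normZ norm_conjC rmorphM /= rmorphXn /= real_normc normrX [leRHS]mulrAC [leRHS]mulrC.
  by rewrite ler_wpM2l ?exprn_ge0// l2norm_mulmx_tr.
rewrite -E -real_normc normcX ler_pM2r ?l2norm_gt0// lecR.
by rewrite leNgt dom.
Qed.

End DominantCoefficient.

(** * A discrete Jensen formula *)

Section Homotopy.
Variable R : realType.
Set Implicit Arguments.
Unset Strict Implicit.
Implicit Types (p : {poly R[i]}) (P : {poly {poly R[i]}}).

Lemma normc_real (x : R) : 0 <= x -> normc x%:C = x.
Proof. by move=> x0; apply: complexI; rewrite real_normc ger0_norm// (lecR 0). Qed.

Lemma le_normcB (x y : R[i]) : normc (x - y) <= normc x + normc y.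
Proof. by apply: le_trans (le_normcD _ _) _; rewrite normcN. Qed.

Lemma ge_normcB (x y : R[i]) : normc x - normc y <= normc (x - y).
Proof. by rewrite lerBlDr; apply: le_trans (le_normcD _ _); rewrite subrK. Qed.

Lemma normc_distC (x y : R[i]) : normc (x - y) = normc (y - x).
Proof. by rewrite -normcN opprB. Qed.

Lemma normc_prod (I : Type) (s : seq I) (F : I -> R[i]) :
  normc (\prod_(i <- s) F i) = \prod_(i <- s) normc (F i).
Proof.
elim/big_ind2: _ => [|x a y b <- <-|//]; first exact: normc1.
exact: normcM.
Qed.

Lemma XnsubC_split N (c : R[i]) : (0 < N)%N ->
  'X^N - c%:P = \prod_(y <- complex_roots ('X^N - c%:P)) ('X - y%:P).
Proof.
move=> N0; rewrite [LHS]complex_rootsP.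
by rewrite (monicP (monicXnsubC _ N0)) scale1r.
Qed.

Lemma size_XnsubC_roots N (c : R[i]) : (0 < N)%N ->
  size (complex_roots ('X^N - c%:P)) = N.
Proof.
move=> N0; have := congr1 (fun q : {poly _} => size q) (XnsubC_split c N0).
by rewrite size_XnsubC// size_prod_XsubC => -[].
Qed.

(** Both sides are the product of the moduli of the differences between the
    [N]-th roots of [c] and the roots of [p], times a power of the modulus of the
    leading coefficient. *)
Lemma prod_horner_XnsubC p N (c : R[i]) : (0 < N)%N ->
  \prod_(y <- complex_roots ('X^N - c%:P)) normc p.[y] =
  normc (lead_coef p) ^+ N * \prod_(z <- complex_roots p) normc (z ^+ N - c).
Proof.
move=> N0; rewrite -[X in _ = _ ^+ X * _](size_XnsubC_roots c N0).
rewrite -[X in _ = X * _]iter_mulr_1 -count_predT -big_const_seq.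
under [X in _ = _ * X]eq_bigr => z _.
  have -> : z ^+ N - c = ('X^N - c%:P).[z] by rewrite !hornerE.
  rewrite XnsubC_split// horner_prod normc_prod.
  under eq_bigr do rewrite hornerXsubC normc_distC.
  over.
rewrite exchange_big. rewrite -big_split /=; apply: eq_bigr => y _.
rewrite {1}[p]complex_rootsP hornerZ horner_prod normcM normc_prod.
by congr (_ * _); apply: eq_bigr => z _; rewrite hornerXsubC.
Qed.

(** On the real axis the squared modulus of a complex polynomial is a real
    polynomial. *)
Lemma sqr_normc_horner_poly p :
  exists g : {poly R}, forall t : R, g.[t] = normc p.[t%:C] ^+ 2.
Proof.
have [f [h pE]] : exists f h : {poly R}, forall t, p.[t%:C] = f.[t] +i* h.[t].
  elim/poly_ind: p => [|p c [f [h pE]]].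
    by exists 0, 0 => t; rewrite !horner0.
  exists (f * 'X + (complex.Re c)%:P), (h * 'X + (complex.Im c)%:P) => t.
  by rewrite !hornerE pE; case: c => a b /=; simpc.
exists (f ^+ 2 + h ^+ 2) => t.
by rewrite pE /= sqr_sqrtr ?addr_ge0 ?sqr_ge0// !hornerE.
Qed.

(** When [c] goes from [U * x] to [U * x ^+ 2], the factor [|w - c|] is
    multiplied by [x], up to a factor 2, if [|w| <= U]; the next lemma shows that
    it changes at most by a factor 2 if [|w| >= U * x ^+ 3]. *)
Lemma inner_root_factor (w : R[i]) (U x : R) : 0 < U -> 4 <= x ->
  normc w <= U ->
  normc (w - (U * x ^+ 2)%:C) <= 2 * x * normc (w - (U * x)%:C) /\
  x * normc (w - (U * x)%:C) <= 2 * normc (w - (U * x ^+ 2)%:C).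
Proof.
move=> U0 x4 wU.
have x0 : 0 < x by lra.
have Ux : 0 <= U * x by rewrite mulr_ge0 ?ltW.
have Uxx : 0 <= U * x ^+ 2 by rewrite mulr_ge0 ?exprn_ge0 ?ltW.
have h1 := le_normcB w (U * x)%:C; have h2 := le_normcB w (U * x ^+ 2)%:C.
have h3 := ge_normcB (U * x)%:C w; have h4 := ge_normcB (U * x ^+ 2)%:C w.
rewrite !(normc_distC _ w) !normc_real// in h1 h2 h3 h4.
split.
  apply: le_trans h2 _.
  apply: (@le_trans _ _ (2 * x * (U * x - U))); last first.
    by rewrite ler_pM2l//; lra.
  by nra.
apply: (@le_trans _ _ (x * (U + U * x))).
  by rewrite ler_pM2l//; lra.
apply: (@le_trans _ _ (2 * (U * x ^+ 2 - U))); last by lra.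
by nra.
Qed.

Lemma outer_root_factor (w : R[i]) (U x : R) : 0 < U -> 4 <= x ->
  U * x ^+ 3 <= normc w ->
  normc (w - (U * x ^+ 2)%:C) <= 2 * normc (w - (U * x)%:C) /\
  normc (w - (U * x)%:C) <= 2 * normc (w - (U * x ^+ 2)%:C).
Proof.
move=> U0 x4 wU.
have x0 : 0 < x by lra.
have Ux : 0 <= U * x by rewrite mulr_ge0 ?ltW.
have Uxx : 0 <= U * x ^+ 2 by rewrite mulr_ge0 ?exprn_ge0 ?ltW.
have h1 := le_normcB w (U * x)%:C; have h2 := le_normcB w (U * x ^+ 2)%:C.
have h3 := ge_normcB w (U * x)%:C; have h4 := ge_normcB w (U * x ^+ 2)%:C.
rewrite !normc_real// in h1 h2 h3 h4.
have k1 : U * x * 4 <= U * x ^+ 2 by have := ler_wpM2l Ux x4; rewrite expr2 mulrA.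
have k2 : U * x ^+ 2 * 4 <= U * x ^+ 3 by have := ler_wpM2l Uxx x4; rewrite (exprSr x 2) mulrA.
by split; lra.
Qed.

(** The product of [|p(y)|] over the [N]-th roots [y] of [c]; for [c > 0] these
    are [N] equally spaced points on the circle of radius the [N]-th root of
    [c]. *)
Definition prod_circle p N (c : R) : R :=
  \prod_(y <- complex_roots ('X^N - c%:C%:P)) normc p.[y].

(** The ratio of the products on two circles of the root-free annulus counts
    the roots inside, up to a factor [2 ^+ D] that does not depend on [N]. *)
Lemma prod_circle_bounds p N (D : nat) (r1 r2 U x : R) :
    (0 < N)%N -> p != 0 -> (size p <= D.+1)%N -> 0 < r1 ->
    U = r1 ^+ N -> 4 <= x -> U * x ^+ 3 <= r2 ^+ N -> 0 <= r2 ->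
    (forall z, r1 < normc z < r2 -> ~~ root p z) ->
  [/\ 0 < prod_circle p N (U * x),
    prod_circle p N (U * x ^+ 2) <=
      2 ^+ D * x ^+ count_roots_le p r1 * prod_circle p N (U * x) &
    x ^+ count_roots_le p r1 * prod_circle p N (U * x) <=
      2 ^+ D * prod_circle p N (U * x ^+ 2)].
Proof.
move=> N0 p0 szp r10 UE x4 Ux3 r20 r12.
have U0 : 0 < U by rewrite UE exprn_gt0.
have x1 : 1 < x by lra.
have x0 : 0 < x by lra.
rewrite /prod_circle !prod_horner_XnsubC//.
set L := _ ^+ N.
have L0 : 0 < L by rewrite exprn_gt0// lt_neqAle normc_ge0 andbT eq_sym;
  apply: contraNneq p0 => /eq0_normc; rewrite -lead_coef_eq0 => ->.
pose w z := if normc z <= r1 then x else 1.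
have wE : x ^+ count_roots_le p r1 = \prod_(z <- complex_roots p) w z.
  by rewrite /w -big_mkcond /= big_const_seq iter_mulr_1.
have szr : (size (complex_roots p) <= D)%N.
  rewrite -ltnS; apply: leq_trans szp.
  by rewrite [in leqRHS](complex_rootsP p) size_scale ?lead_coef_eq0// size_prod_XsubC.
have bnd z : z \in complex_roots p ->
  [/\ 0 < normc (z ^+ N - (U * x)%:C),
   normc (z ^+ N - (U * x ^+ 2)%:C) <= 2 * w z * normc (z ^+ N - (U * x)%:C) &
   w z * normc (z ^+ N - (U * x)%:C) <= 2 * normc (z ^+ N - (U * x ^+ 2)%:C)].
  rewrite mem_complex_roots// => rz.
  rewrite /w; have [zr1|zr1] := leP (normc z) r1.
    have zU : normc (z ^+ N) <= U.
      by rewrite normcX UE; apply: lerXn2r; [exact: normc_ge0|exact: ltW|].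
    have [h1 h2] := inner_root_factor U0 x4 zU; split=> //.
    rewrite normc_distC; apply: lt_le_trans (ge_normcB _ _).
    rewrite normc_real; last by rewrite mulr_ge0 ?ltW.
    by rewrite subr_gt0; apply: le_lt_trans zU _; rewrite ltr_pMr.
  have zr2 : r2 <= normc z.
    by rewrite leNgt; apply/negP => zr2; have := r12 z; rewrite zr1 zr2 rz => /(_ isT).
  have zU : U * x ^+ 3 <= normc (z ^+ N).
    by apply: le_trans Ux3 _; rewrite normcX; apply: lerXn2r; [|exact: normc_ge0|].
  have [h1 h2] := outer_root_factor U0 x4 zU; rewrite mulr1 mul1r; split=> //.
  apply: lt_le_trans (ge_normcB _ _).
  rewrite normc_real; last by rewrite mulr_ge0 ?ltW.
  rewrite subr_gt0; apply: lt_le_trans zU.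
  by rewrite ltr_pM2l// exprS -[ltLHS]mulr1 ltr_pM2l// exprn_egt1.
have two_pow : \prod_(z <- complex_roots p) (2 : R) <= 2 ^+ D.
  by rewrite big_const_seq iter_mulr_1 count_predT ler_weXn2l// ler1n.
have prod_ge0 c : 0 <= \prod_(z <- complex_roots p) normc (z ^+ N - c).
  by apply: prodr_ge0 => z _; apply: normc_ge0.
split.
- rewrite mulr_gt0// big_seq; apply: prodr_gt0 => z zp.
  by have [] := bnd z zp.
- rewrite [leRHS]mulrCA ler_pM2l// wE.
  apply: (@le_trans _ _ (\prod_(z <- complex_roots p) 2 *
     \prod_(z <- complex_roots p) w z *
     \prod_(z <- complex_roots p) normc (z ^+ N - (U * x)%:C))); last first.
    rewrite -!mulrA ler_wpM2r// mulr_ge0// prodr_ge0// => z _.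
    by rewrite /w; case: ifP => _; rewrite ?ler01 ?(ltW x0).
  rewrite -!big_split /= [leLHS]big_seq [leRHS]big_seq.
  by apply: ler_prod => z zp; rewrite normc_ge0; have [] := bnd z zp.
- rewrite [leLHS]mulrCA [leRHS]mulrCA ler_pM2l// wE.
  apply: (@le_trans _ _ (\prod_(z <- complex_roots p) 2 *
     \prod_(z <- complex_roots p) normc (z ^+ N - (U * x ^+ 2)%:C))); last first.
    by rewrite ler_wpM2r.
  rewrite -!big_split /= [leLHS]big_seq [leRHS]big_seq.
  apply: ler_prod => z zp; have [h1 h2 ->] := bnd z zp; rewrite andbT mulr_ge0 ?normc_ge0//.
  by rewrite /w; case: ifP => _; rewrite ?ler01 ?(ltW x0).
Qed.

End Homotopy.

(** * Homotopy invariance of the number of roots in a disc *)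

Section HomotopyInvariance.
Variable R : realType.
Set Implicit Arguments.
Unset Strict Implicit.
Implicit Types (p : {poly R[i]}) (P : {poly {poly R[i]}}).

(** In a bivariate polynomial [P], the outer variable is the homotopy parameter
    and the coefficients are polynomials in the variable [z]. *)
Lemma sqr_prod_circle_poly P N (c : R) :
  exists g : {poly R}, forall t : R, g.[t] = prod_circle P.[t%:C%:P] N c ^+ 2.
Proof.
rewrite /prod_circle; elim: (complex_roots _) => [|y ys [g gE]].
  by exists 1 => t; rewrite big_nil expr1n hornerC.
have [h hE] := sqr_normc_horner_poly (map_poly (horner_eval y) P).
exists (h * g) => t; rewrite big_cons exprMn hornerM gE hE; congr (normc _ ^+ 2 * _).
by have := horner_map (horner_eval y) P t%:C%:P; rewrite /= /horner_eval hornerC.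
Qed.

Lemma Bernoulli_ge (e : R) N : 0 <= e -> 1 + N%:R * e <= (1 + e) ^+ N.
Proof.
move=> e0; elim: N => [|N IHN]; first by rewrite mul0r addr0 expr0.
rewrite exprS; apply: (@le_trans _ _ ((1 + e) * (1 + N%:R * e))); last first.
  by rewrite ler_wpM2l// addr_ge0.
rewrite -natr1; have : 0 <= N%:R * (e * e) by rewrite !mulr_ge0.
by move: (N%:R) => v; lra.
Qed.

Lemma exprn_unbounded (q M : R) : 1 < q -> exists2 N, (0 < N)%N & M <= q ^+ N.
Proof.
move=> q1; pose e := q - 1; have e0 : 0 < e by rewrite subr_gt0.
have [N MN] : exists N : nat, M / e <= N%:R.
  have [h|h] := leP (M / e) 0; first by exists 0%N.
  by exists (Num.trunc (M / e)).+1; apply: ltW; apply: truncnS_gt.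
exists N.+1 => //; have -> : q = 1 + e by rewrite /e; lra.
apply: le_trans (Bernoulli_ge _ (ltW e0)).
have : M <= N%:R * e by rewrite -ler_pdivrMr.
by rewrite -natr1; move: (N%:R) => v; lra.
Qed.

Lemma cube_root_above_1 (a b : R) : 0 < a -> a < b ->
  exists2 q, 1 < q & a * q ^+ 3 <= b.
Proof.
move=> a0 ab; pose e := Num.min 1 ((b / a - 1) / 7).
have e0 : 0 < e.
  by rewrite /e lt_min ltr01 divr_gt0// subr_gt0 ltr_pdivlMr ?mul1r.
have e1 : e <= 1 by rewrite /e ge_min lexx.
have eb : e <= (b / a - 1) / 7 by rewrite /e ge_min lexx orbT.
exists (1 + e); first by lra.
rewrite mulrC -ler_pdivlMr//.
apply: (@le_trans _ _ (1 + 7 * e)); last by lra.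
by clear eb; move: e0 e1; clearbody e => e0 e1; nra.
Qed.

(** The parameters [a] and [b] come in either order, so that the converse
    inequality follows by exchanging them. *)
Lemma count_roots_le_homotopy_lt P (a b r1 r2 : R) :
    0 < r1 -> r1 < r2 ->
    (forall t z, Num.min a b <= t <= Num.max a b ->
       r1 < normc z < r2 -> ~~ root P.[t%:C%:P] z) ->
  (count_roots_le P.[b%:C%:P] r1 <= count_roots_le P.[a%:C%:P] r1)%N.
Proof.
move=> r10 r12 noroot; rewrite leqNgt; apply/negP => lt_ab.
have [q q1 qr] := cube_root_above_1 r10 r12.
have [D szP] : exists D, forall t, (size P.[t%:C%:P] <= D.+1)%N.
  exists (\max_(i < size P) size (P`_i)%R) => t.
  rewrite horner_coef; apply: leqW; apply: leq_trans (size_sum _ _ _) _.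
  apply/bigmax_leqP => i _; rewrite -rmorphXn /= mulrC mul_polyC.
  apply: leq_trans (size_scale_leq _ _) _.
  exact: (@leq_bigmax _ (fun i : 'I_(size P) => size (P`_i)%R)).
(* With [x] larger than [2 * 4 ^+ D], the ranges of the ratio that belong to
   different root counts are disjoint. *)
have [N N0 qN] := exprn_unbounded (4 * 4 ^+ D) q1.
set x := q ^+ N in qN.
have x4 : 4 <= x.
  by apply: le_trans qN; rewrite ler_peMr// exprn_ege1// ler1n.
have x1 : 1 < x by apply: lt_le_trans x4; rewrite ltr1n.
have x0 : 0 < x by apply: lt_trans x1; rewrite ltr01.
pose U := r1 ^+ N.
have Ux : U * x ^+ 3 <= r2 ^+ N.
  rewrite /U /x -exprM mulnC exprM -exprMn lerXn2r// ?nnegrE.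
    by rewrite mulr_ge0 ?exprn_ge0 ?ltW// (lt_trans ltr01).
  by rewrite ltW// (lt_trans r10).
clearbody x.
have bounds t : Num.min a b <= t <= Num.max a b ->
  [/\ 0 < prod_circle P.[t%:C%:P] N (U * x),
    prod_circle P.[t%:C%:P] N (U * x ^+ 2) <=
      2 ^+ D * x ^+ count_roots_le P.[t%:C%:P] r1 * prod_circle P.[t%:C%:P] N (U * x) &
    x ^+ count_roots_le P.[t%:C%:P] r1 * prod_circle P.[t%:C%:P] N (U * x) <=
      2 ^+ D * prod_circle P.[t%:C%:P] N (U * x ^+ 2)].
  move=> tab; apply: (prod_circle_bounds N0 _ _ r10 _ x4 Ux) => //.
  - pose m : R := (r1 + r2) / 2.
    have mr : r1 < normc m%:C < r2.
      by rewrite normc_real /m; [apply/andP; split; lra|lra].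
    by apply: contraNneq (noroot t _ tab mr) => ->; rewrite root0.
  - by rewrite ltW// (lt_trans r10).
  - by move=> z; apply: noroot.
have [g1 g1E] := sqr_prod_circle_poly P N (U * x).
have [g2 g2E] := sqr_prod_circle_poly P N (U * x ^+ 2).
(* The level [L] lies above every ratio for at most [ca] roots and below every
   ratio for more than [ca] roots, so [f] below never vanishes. *)
set ca := count_roots_le _ _ in lt_ab.
pose L := 2 * (2 ^+ D * x ^+ ca).
have tw : 0 < 2 ^+ D :> R by rewrite exprn_gt0.
have L0 : 0 < L by rewrite /L !mulr_gt0 ?ltr0n// exprn_gt0.
pose f := g2 - (L ^+ 2) *: g1.
have fE t : f.[t] = prod_circle P.[t%:C%:P] N (U * x ^+ 2) ^+ 2 -
     (L * prod_circle P.[t%:C%:P] N (U * x)) ^+ 2.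
  by rewrite /f hornerD hornerN hornerZ g1E g2E [in RHS]exprMn.
have pc_ge0 p c : 0 <= prod_circle p N c.
  by apply: prodr_ge0 => y _; apply: normc_ge0.
have f_lo t : Num.min a b <= t <= Num.max a b ->
    (count_roots_le P.[t%:C%:P] r1 <= ca)%N -> f.[t] < 0.
  move=> /bounds[J0 J1 _] c_le; rewrite fE subr_lt0 ltr_pXn2r ?nnegrE//; last first.
    by rewrite mulr_ge0// ltW.
  apply: le_lt_trans J1 _; rewrite ltr_pM2r// /L.
  apply: (@le_lt_trans _ _ (2 ^+ D * x ^+ ca)).
    by rewrite ler_pM2l// ler_weXn2l// ltW.
  by rewrite -[ltLHS]mul1r ltr_pM2r ?ltr1n// mulr_gt0// exprn_gt0.
have f_hi t : Num.min a b <= t <= Num.max a b ->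
    (ca < count_roots_le P.[t%:C%:P] r1)%N -> 0 < f.[t].
  move=> /bounds[J0 _ J2] c_gt; rewrite fE subr_gt0 ltr_pXn2r ?nnegrE//; last first.
    by rewrite mulr_ge0// ltW.
  rewrite -(ltr_pM2l tw); apply: lt_le_trans J2; rewrite mulrA ltr_pM2r//.
  apply: (@lt_le_trans _ _ (x ^+ ca.+1)); last by rewrite ler_weXn2l// ltW.
  have -> : 2 ^+ D * L = x ^+ ca * (2 * 4 ^+ D).
    have -> : 4 ^+ D = 2 ^+ D * 2 ^+ D :> R by rewrite -exprMn -natrM.
    by rewrite /L; move: (2 ^+ D) (x ^+ ca) => v w; ring.
  rewrite exprSr ltr_pM2l ?exprn_gt0//; apply: lt_le_trans qN.
  by rewrite ltr_pM2r ?exprn_gt0// ltr_nat.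
have aab : Num.min a b <= a <= Num.max a b by rewrite ge_min le_max lexx.
have bab : Num.min a b <= b <= Num.max a b by rewrite ge_min le_max lexx !orbT.
have fab : f.[a] * f.[b] < 0.
  by rewrite nmulr_rlt0; [apply: f_hi | apply: f_lo].
have [t tab] : exists2 t, Num.min a b <= t <= Num.max a b & root f t.
  have [ab|ba] := leP a b.
    have [t] := poly_ivtoo ab fab; rewrite in_itv /= => /andP[t1 t2] rt.
    by exists t => //; rewrite !ltW.
  rewrite mulrC in fab.
  have [t] := poly_ivtoo (ltW ba) fab; rewrite in_itv /= => /andP[t1 t2] rt.
  by exists t => //; rewrite !ltW.
move=> /rootP ft; case: (leqP (count_roots_le P.[t%:C%:P] r1) ca) => c.
  by have := f_lo _ tab c; rewrite ft ltxx.
by have := f_hi _ tab c; rewrite ft ltxx.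
Qed.

Lemma count_roots_le_homotopy P (a b r1 r2 : R) :
    a <= b -> 0 < r1 -> r1 < r2 ->
    (forall t z, a <= t <= b -> r1 < normc z < r2 -> ~~ root P.[t%:C%:P] z) ->
  count_roots_le P.[a%:C%:P] r1 = count_roots_le P.[b%:C%:P] r1.
Proof.
move=> ab r10 r12 noroot; apply/eqP; rewrite eqn_leq.
apply/andP; split; apply: (count_roots_le_homotopy_lt r10 r12) => t z.
  by rewrite (min_idPr ab) (max_idPl ab); apply: noroot.
by rewrite (min_idPl ab) (max_idPr ab); apply: noroot.
Qed.

End HomotopyInvariance.

(** * Coefficients of the scalar polynomial *)

Section PelletPolynomial.
Variable R : realType.
Set Implicit Arguments.
Unset Strict Implicit.
Variables (m n : nat) (A : 'I_n.+1 -> 'M[R[i]]_m).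

Lemma horner_pellet_poly (k : 'I_n.+1) (x : R) :
  (pellet_poly A k).[x] =
  x ^+ k - \sum_(i < n.+1 | i != k) pellet_coef A k i * x ^+ i.
Proof.
rewrite /pellet_poly hornerD hornerN hornerXn horner_sum; congr (_ - _).
by apply: eq_bigr => i _; rewrite hornerZ hornerXn.
Qed.

Lemma coef_pellet_poly (k i : 'I_n.+1) :
  (pellet_poly A k)`_i = if i == k then 1 else - pellet_coef A k i.
Proof.
rewrite /pellet_poly coefB coefXn coef_sum -val_eqE /=.
move: (pellet_coef A k) => c.
under eq_bigr do rewrite coefZ coefXn.
case: eqP => [/val_inj ->|/eqP ik].
  rewrite big1 ?subr0// => j; rewrite -val_eqE /= eq_sym => /negPf ->.
  by rewrite mulr0.
rewrite sub0r (bigD1 i)//= eqxx mulr1 big1 ?addr0// => j /andP[_].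
by rewrite -val_eqE /= eq_sym => /negPf ->; rewrite mulr0.
Qed.

Lemma size_pellet_poly k : (size (pellet_poly A k) <= n.+1)%N.
Proof.
apply: leq_trans (size_polyD _ _) _; rewrite geq_max size_polyXn ltn_ord size_polyN.
apply: leq_trans (size_sum _ _ _) _; apply/bigmax_leqP => i _.
by apply: leq_trans (size_scale_leq _ _) _; rewrite size_polyXn.
Qed.

Lemma pellet_coef_ge0 k i : 0 <= pellet_coef A k i.
Proof. exact: spectral_norm_ge0. Qed.

Lemma pellet_coef_gt0 k i : \det (A k) != 0 -> A i != 0 -> 0 < pellet_coef A k i.
Proof.
move=> Ak Ai; rewrite lt_neqAle pellet_coef_ge0 andbT eq_sym.
apply: contraNneq Ai => /spectral_norm_eq0 h.
have Aku : A k \in unitmx by rewrite unitmxE unitfE.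
by rewrite -[A i](mulKVmx Aku) h mulmx0.
Qed.

Lemma coef_pellet_poly_le0 (k : 'I_n.+1) (i : nat) : i != k -> (pellet_poly A k)`_i <= 0.
Proof.
move=> ik; have [lei|lti] := leqP n.+1 i.
  by rewrite nth_default// (leq_trans (size_pellet_poly k)).
have := coef_pellet_poly k (Ordinal lti); rewrite /= ifN// => ->.
by rewrite oppr_le0 pellet_coef_ge0.
Qed.

End PelletPolynomial.

(** * The homotopy from the dominant term to the matrix polynomial *)

Section MatrixHomotopy.
Variable R : realType.
Set Implicit Arguments.
Unset Strict Implicit.
Variables (m n : nat) (A : 'I_n.+1 -> 'M[R[i]]_m) (k : 'I_n.+1).

(** The determinant of [A_k x^k + T \sum_(i != k) A_i x^i] as a polynomial in
    the outer variable [T] with coefficients in the polynomials in [x]. *)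
Definition homotopy_poly : {poly {poly R[i]}} :=
  \det (map_mx polyC ('X^k *: map_mx polyC (A k)) +
        'X *: map_mx polyC (\sum_(i < n.+1 | i != k) 'X^i *: map_mx polyC (A i))).

Lemma horner_homotopy_poly (t : R) :
  homotopy_poly.[t%:C%:P] =
  \det ('X^k *: map_mx polyC (A k) +
        t%:C%:P *: \sum_(i < n.+1 | i != k) 'X^i *: map_mx polyC (A i)).
Proof.
rewrite -[LHS]/(horner_eval t%:C%:P _) -det_map_mx; congr (\det _).
by apply/matrixP => i j; rewrite !mxE /= horner_evalE hornerD hornerM hornerX !hornerC.
Qed.

Lemma horner2_homotopy_poly (t : R) (z : R[i]) :
  homotopy_poly.[t%:C%:P].[z] =
  \det (z ^+ k *: A k + t%:C *: \sum_(i < n.+1 | i != k) z ^+ i *: A i).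
Proof.
rewrite horner_homotopy_poly -[LHS]/(horner_eval z _) -det_map_mx; congr (\det _).
apply/matrixP => i j; rewrite !mxE /= horner_evalE !summxE.
rewrite hornerD !hornerM !hornerC hornerXn horner_sum.
by congr (_ + _ * _); apply: eq_bigr => l _; rewrite !mxE hornerM hornerC hornerXn.
Qed.

Lemma homotopy_poly1 : homotopy_poly.[1%:C%:P] = det_poly A.
Proof.
by rewrite horner_homotopy_poly scale1r /det_poly /matrix_poly [in RHS](bigD1 k).
Qed.

Lemma homotopy_poly0 :
  homotopy_poly.[0%:C%:P] = \det (A k) *: 'X^(m * k).
Proof.
rewrite horner_homotopy_poly (_ : 0%:C%:P = 0) ?rmorph0// scale0r addr0.
by rewrite detZ det_map_mx -exprM mulnC mulrC mul_polyC.
Qed.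

Lemma count_roots_le_homotopy_poly0 r : \det (A k) != 0 -> 0 <= r ->
  count_roots_le homotopy_poly.[0%:C%:P] r = (m * k)%N.
Proof.
move=> Ak r0; rewrite homotopy_poly0 /count_roots_le.
set p := _ *: _.
have p0 : p != 0 by rewrite scaler_eq0 negb_or Ak -size_poly_eq0 size_polyXn.
have szr : size (complex_roots p) = (m * k)%N.
  apply: succn_inj; rewrite -[LHS](size_prod_XsubC _ id).
  rewrite -(@size_scale _ (lead_coef p)) ?lead_coef_eq0// -complex_rootsP.
  by rewrite /p size_scale// size_polyXn.
rewrite -[RHS]szr; apply/eqP; rewrite -all_count; apply/allP => z.
rewrite mem_complex_roots// /p rootZ// rootE hornerXn => /eqP/eqP.
by rewrite expf_eq0 => /andP[_ /eqP ->]; rewrite normc0.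
Qed.

Lemma homotopy_poly_nonroot t z : \det (A k) != 0 -> 0 <= t ->
  t * (\sum_(i < n.+1 | i != k) pellet_coef A k i * normc z ^+ i)
    < normc z ^+ k ->
  ~~ root homotopy_poly.[t%:C%:P] z.
Proof. by move=> Ak t0 dom; rewrite rootE horner2_homotopy_poly det_dominant_ne0. Qed.

Lemma homotopy_poly_nonroot_le1 t z : \det (A k) != 0 -> 0 <= t <= 1 ->
  0 < (pellet_poly A k).[normc z] -> ~~ root homotopy_poly.[t%:C%:P] z.
Proof.
move=> Ak /andP[t0 t1]; rewrite horner_pellet_poly subr_gt0 => q0.
apply: homotopy_poly_nonroot => //; apply: le_lt_trans q0.
rewrite ler_piMl// sumr_ge0// => i _.
by rewrite mulr_ge0 ?pellet_coef_ge0// exprn_ge0// normc_ge0.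
Qed.

Lemma det_poly_nonroot z : \det (A k) != 0 ->
  0 < (pellet_poly A k).[normc z] -> ~~ root (det_poly A) z.
Proof.
by move=> Ak; rewrite -homotopy_poly1; apply: homotopy_poly_nonroot_le1; rewrite ?ler01 ?lexx.
Qed.

End MatrixHomotopy.

(** * Root counts in a closed disc under passage to the limit *)

Section DoubleRoot.
Variable R : realType.
Set Implicit Arguments.
Unset Strict Implicit.

Lemma horner_bounded (p : {poly R[i]}) (M : R) : 0 <= M ->
  exists2 K, 0 <= K & forall z, normc z <= M -> normc p.[z] <= K.
Proof.
move=> M0; elim/poly_ind: p => [|p c [K K0 pK]].
  by exists 0 => // z _; rewrite horner0 normc0.
exists (K * M + normc c) => [|z zM]; first by rewrite addr_ge0 ?mulr_ge0 ?normc_ge0.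
rewrite !hornerE; apply: le_trans (le_normcD _ _) _; rewrite lerD2r normcM.
by apply: ler_pM; rewrite ?normc_ge0// pK.
Qed.

Lemma horner2_bounded (P : {poly {poly R[i]}}) (M : R) : 0 <= M ->
  exists2 K, 0 <= K & forall t z, 0 <= t <= 1 -> normc z <= M ->
    normc P.[t%:C%:P].[z] <= K.
Proof.
move=> M0; elim/poly_ind: P => [|P c [K K0 PK]].
  by exists 0 => // t z _ _; rewrite !horner0 normc0.
have [L L0 cL] := horner_bounded c M0.
exists (K + L) => [|t z t01 zM]; first by rewrite addr_ge0.
rewrite hornerD hornerMX hornerC hornerD hornerM hornerC.
apply: le_trans (le_normcD _ _) _; apply: lerD; last exact: cL.
have /andP[t0 t1] := t01.
rewrite normcM (normc_real t0) -[leRHS]mulr1.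
by apply: ler_pM; rewrite ?normc_ge0 ?PK.
Qed.

Lemma horner2_lipschitz1 (P : {poly {poly R[i]}}) (M : R) : 0 <= M ->
  exists2 K, 0 <= K & forall t z, 0 <= t <= 1 -> normc z <= M ->
    normc (P.[t%:C%:P].[z] - P.[1%:C%:P].[z]) <= (1 - t) * K.
Proof.
move=> M0; have [Q PQ] : exists Q, P - P.[1%:C%:P]%:P = ('X - 1%:C%:P%:P) * Q.
  have : root (P - P.[1%:C%:P]%:P) 1%:C%:P by rewrite rootE hornerD hornerN hornerC subrr.
  by case/factor_theorem => Q ->; exists Q; rewrite mulrC.
have [K K0 QK] := horner2_bounded Q M0; exists K => // t z t01 zM.
have -> : P.[t%:C%:P].[z] - P.[1%:C%:P].[z] = (t - 1)%:C * Q.[t%:C%:P].[z].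
  have := congr1 (fun q : {poly {poly R[i]}} => q.[t%:C%:P].[z]) PQ.
  rewrite hornerM hornerXsubC hornerD hornerN hornerC => E.
  by rewrite -hornerN -hornerD E hornerM -polyCB hornerC rmorphB.
have /andP[t0 t1] := t01.
rewrite normcM; have -> : normc (t - 1)%:C = 1 - t.
  by rewrite -normcN -rmorphN opprB normc_real// subr_ge0.
by rewrite ler_wpM2l ?subr_ge0// QK.
Qed.

(** The finitely many roots outside a disc stay away from it. *)
Lemma root_free_annulus (p : {poly R[i]}) (s : R) : p != 0 ->
  exists2 rho, s < rho & forall z, s < normc z < rho -> ~~ root p z.
Proof.
move=> p0; suff [rho srho rhoP] : exists2 rho, s < rho &
    forall z, z \in complex_roots p -> s < normc z -> rho <= normc z.
  exists rho => // z /andP[sz zr]; rewrite -mem_complex_roots//.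
  by apply: contraTN zr => /rhoP/(_ sz); rewrite -leNgt.
elim: (complex_roots p) => [|y ys [rho srho rhoP]].
  by exists (s + 1); [rewrite ltrDl ltr01|].
exists (if s < normc y then Num.min rho (normc y) else rho).
  by case: ifP => // sy; rewrite lt_min srho.
move=> z; rewrite inE => /orP[/eqP ->|zys] sz.
  by rewrite sz ge_min lexx orbT.
by case: ifP => _; rewrite ?ge_min rhoP.
Qed.

(** [p] is bounded away from zero on the middle third of a root-free annulus:
    each of its linear factors is. *)
Lemma horner_lower_bound (p : {poly R[i]}) (s rho : R) : p != 0 -> s < rho ->
    (forall z, s < normc z < rho -> ~~ root p z) ->
  exists r r' delta, [/\ s < r, r < r', r' < rho, 0 < delta &
    forall z, r <= normc z <= r' -> delta <= normc p.[z]].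
Proof.
move=> p0 srho nr; pose e := (rho - s) / 3.
have e0 : 0 < e by rewrite divr_gt0// subr_gt0.
have rhoE : rho = s + 3 * e by rewrite /e; lra.
exists (s + e), (s + 2 * e), (normc (lead_coef p) * e ^+ size (complex_roots p)).
split; [lra|lra|lra| |].
  rewrite mulr_gt0 ?exprn_gt0// lt_neqAle normc_ge0 andbT eq_sym.
  by apply: contraNneq p0 => /eq0_normc; rewrite -lead_coef_eq0 => ->.
move=> z /andP[rz zr]; rewrite [p in p.[z]]complex_rootsP hornerZ horner_prod normcM normc_prod.
rewrite ler_wpM2l ?normc_ge0// -count_predT -iter_mulr_1 -big_const_seq.
rewrite big_seq [leRHS]big_seq; apply: ler_prod => y.
rewrite mem_complex_roots// => py; rewrite hornerXsubC (ltW e0) /=.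
have [ys|sy] := leP (normc y) s.
  by apply: le_trans (ge_normcB _ _); lra.
have rhoy : rho <= normc y.
  by rewrite leNgt; apply/negP => yrho; have := nr y; rewrite sy yrho py => /(_ isT).
by rewrite normc_distC; apply: le_trans (ge_normcB _ _); lra.
Qed.

Lemma count_roots_le_mono (p : {poly R[i]}) (r r' : R) : r <= r' ->
  (count_roots_le p r <= count_roots_le p r')%N.
Proof. by move=> rr'; apply: sub_count => z /= /le_trans; apply. Qed.

(** Just outside the closed disc there is an annulus on which the limit
    polynomial is bounded away from 0.  The polynomials with [t] near 1 have no
    root there, and so as many roots inside as the limit. *)
Lemma count_roots_le_limit (P : {poly {poly R[i]}}) (s : R) c : 0 < s ->
    P.[1%:C%:P] != 0 ->
    (forall t, 0 < t < 1 -> (c <= count_roots_le P.[t%:C%:P] s)%N) ->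
  (c <= count_roots_le P.[1%:C%:P] s)%N.
Proof.
move=> s0 P1 ct.
have [rho srho nr] := root_free_annulus s P1.
have [r [r' [delta [sr rr' r'rho d0 dP]]]] := horner_lower_bound P1 srho nr.
have r0 : 0 < r by apply: lt_trans sr.
have [K K0 KP] := horner2_lipschitz1 P (ltW (lt_trans r0 rr')).
(* For [t >= 1 - h], the distance to the limit is at most [h * K < delta]. *)
pose h := Num.min (1 / 2) (delta / (2 * (K + 1))).
have K1 : 0 < K + 1 by lra.
have h0 : 0 < h by rewrite lt_min !divr_gt0// mulr_gt0.
have h2 : h <= 1 / 2 by rewrite ge_min lexx.
have hK : h * K < delta.
  have : h <= delta / (2 * (K + 1)) by rewrite ge_min lexx orbT.
  rewrite ler_pdivlMr ?mulr_gt0// => hd.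
  have : 0 <= h * K by rewrite mulr_ge0// ltW.
  by clearbody h; lra.
clearbody h; pose t0 := 1 - h.
have t01 : t0 <= 1 by rewrite /t0; lra.
have -> : count_roots_le P.[1%:C%:P] s = count_roots_le P.[1%:C%:P] r.
  apply: eq_in_count => z; rewrite mem_complex_roots// => rz.
  apply/idP/idP => [/le_trans|zr]; first by apply; apply: ltW.
  rewrite leNgt; apply/negP => sz; have := nr z.
  by rewrite sz rz (le_lt_trans zr (lt_trans rr' r'rho)) => /(_ isT).
rewrite -(@count_roots_le_homotopy _ P t0 1 r r')//.
  apply: leq_trans (count_roots_le_mono _ (ltW sr)).
  by apply: ct; rewrite /t0; apply/andP; split; lra.
move=> t z /andP[t0t t1] /andP[rz zr']; apply/negP => /rootP Pz.
have t_ge0 : 0 <= t by move: t0t; rewrite /t0; lra.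
have := KP t z; rewrite t_ge0 t1 (ltW zr') Pz sub0r normcN => /(_ isT isT) Pz1.
have := dP z; rewrite (ltW rz) (ltW zr') => /(_ isT) /le_trans /(_ Pz1).
apply/negP; rewrite -ltNge; apply: le_lt_trans hK; rewrite ler_wpM2r//.
by move: t0t; rewrite /t0; lra.
Qed.

End DoubleRoot.

(** * Location of the roots of the determinant *)

Section Pellet.
Variable R : realType.
Set Implicit Arguments.
Unset Strict Implicit.
Variables (m n : nat) (A : 'I_n.+1 -> 'M[R[i]]_m).
Hypotheses (A0 : A ord0 != 0) (An : A ord_max != 0).

Section Middle.
Variable k : 'I_n.+1.
Hypotheses (k_mid : (0 < k < n)%N) (Ak : \det (A k) != 0).
Local Notation q := (pellet_poly A k).

Lemma pellet_poly_factor s : 0 < s -> root q s ->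
  exists t r, [/\ 0 < t, q = ('X - s%:P) * (t%:P - 'X) * r &
                 forall x, 0 < x -> 0 < r.[x]].
Proof.
move=> s0 qs; apply: (@two_sign_changes _ q k n) => //.
- exact: size_pellet_poly.
- by move=> i; apply: coef_pellet_poly_le0.
- have := coef_pellet_poly A k ord0; rewrite -val_eqE /= ltn_eqF => [->|].
    by rewrite oppr_lt0 pellet_coef_gt0.
  by case/andP: k_mid.
- have := coef_pellet_poly A k ord_max; rewrite -val_eqE /= gtn_eqF => [->|].
    by rewrite oppr_lt0 pellet_coef_gt0.
  by case/andP: k_mid.
Qed.

Lemma pellet_poly_neq0 : q != 0.
Proof.
apply/eqP => q0; have := coef_pellet_poly A k k.
by rewrite q0 coef0 eqxx => /eqP; rewrite eq_sym oner_eq0.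
Qed.

Lemma pellet_poly_positive_roots :
  positive_roots q [::] \/ exists s t, s <= t /\ positive_roots q [:: s; t].
Proof.
have [[s [s0 qs]]|noroot] := boolp.EM (exists s, 0 < s /\ root q s); last first.
  left; apply: positive_roots_nil => x x0; apply/negP => qx.
  by apply: noroot; exists x.
right; have [t [r [t0 qE r0]]] := pellet_poly_factor s0 qs.
have [st|ts] := leP s t.
  by exists s, t; split=> //; apply: positive_roots2 qE r0.
exists t, s; split; first exact: ltW.
apply: (@positive_roots2 _ q r) => //; rewrite qE; ring.
Qed.

Lemma positive_roots_pellet_poly_factor s t : positive_roots q [:: s; t] ->
  [/\ 0 < s, 0 < t & exists r, q = ('X - s%:P) * (t%:P - 'X) * r /\
    forall x, 0 < x -> 0 < r.[x]].
Proof.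
move=> st; have [lpos lP] := st.
have s0 : 0 < s by apply: lpos; rewrite mem_head.
have t0 : 0 < t by apply: lpos; rewrite !inE eqxx orbT.
split=> //.
have qs : root q s.
  by apply: (positive_roots_root pellet_poly_neq0 st); rewrite mem_head.
have [t' [r [t'0 qE r0]]] := pellet_poly_factor s0 qs.
have [_ lP'] := positive_roots2 s0 t'0 qE r0.
have := lP t t0; rewrite -lP'// /= eqxx addn0 => /addnI.
by case: eqP => // <- _; exists r.
Qed.

Lemma pellet_poly_gt0_between s t x : positive_roots q [:: s; t] ->
  s < x < t -> 0 < q.[x].
Proof.
case/positive_roots_pellet_poly_factor=> s0 t0 [r [-> r0]] /andP[sx xt].
rewrite !hornerM hornerXsubC hornerD hornerN hornerC hornerX.
by rewrite !mulr_gt0 ?subr_gt0// r0// (lt_trans s0).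
Qed.

Lemma det_poly_nonroot_annulus s t z : positive_roots q [:: s; t] ->
  s < normc z < t -> ~~ root (det_poly A) z.
Proof.
by move=> st szt; apply: (det_poly_nonroot Ak); apply: pellet_poly_gt0_between st szt.
Qed.

(** Homotopy on the whole annulus between two distinct solutions. *)
Lemma count_roots_le_strict s t : positive_roots q [:: s; t] -> s < t ->
  count_roots_le (det_poly A) s = (m * k)%N.
Proof.
move=> st lt_st; have [s0 t0 _] := positive_roots_pellet_poly_factor st.
rewrite -(homotopy_poly1 A k) -(count_roots_le_homotopy_poly0 Ak (ltW s0)).
apply/esym; apply: (count_roots_le_homotopy ler01 s0 lt_st) => tau z t01 szt.
exact: homotopy_poly_nonroot_le1 Ak t01 (pellet_poly_gt0_between st szt).
Qed.

(** At a solution [s] the scalar equation becomes a strict inequality once the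
    right-hand side is multiplied by [tau < 1], and it remains strict slightly
    outside; this leaves a root-free annulus around the disc of radius [s], even
    when [s] is a double solution. *)
Lemma count_roots_le_before s tau : 0 < s -> root q s -> 0 < tau < 1 ->
  count_roots_le (homotopy_poly A k).[tau%:C%:P] s = (m * k)%N.
Proof.
move=> s0 qs /andP[tau0 tau1].
pose Sig x : R := \sum_(i < n.+1 | i != k) pellet_coef A k i * x ^+ i.
have Sig_ge0 x : 0 <= x -> 0 <= Sig x.
  move=> x0; apply: sumr_ge0 => i _.
  by rewrite mulr_ge0 ?pellet_coef_ge0 ?exprn_ge0.
pose h : {poly R} := tau *: q + (1 - tau) *: 'X^k.
have hE x : h.[x] = x ^+ k - tau * Sig x.
  by rewrite /h hornerD !hornerZ hornerXn horner_pellet_poly /Sig; ring.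
have hs : 0 < h.[s].
  rewrite /h hornerD !hornerZ hornerXn (rootP qs) mulr0 add0r.
  by rewrite mulr_gt0 ?exprn_gt0// subr_gt0.
have [d d0 dP] := poly_cont s h hs.
rewrite -(count_roots_le_homotopy_poly0 Ak (ltW s0)).
have ssd : s < s + d by rewrite ltrDl.
apply/esym; apply: (count_roots_le_homotopy (ltW tau0) s0 ssd) => t z.
move=> /andP[t0 ttau] /andP[sz zd]; apply: (homotopy_poly_nonroot Ak t0).
apply: (@le_lt_trans _ _ (tau * Sig (normc z))).
  by rewrite ler_wpM2r// Sig_ge0// normc_ge0.
rewrite -subr_gt0 -hE.
have /dP : `|normc z - s| < d by rewrite ger0_norm; lra.
by rewrite ltr_distl => /andP[]; rewrite subrr.
Qed.

Lemma count_roots_le_ge s t : det_poly A != 0 -> positive_roots q [:: s; t] ->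
  (m * k <= count_roots_le (det_poly A) s)%N.
Proof.
move=> pA st; have [s0 t0 _] := positive_roots_pellet_poly_factor st.
have qs : root q s.
  by apply: (positive_roots_root pellet_poly_neq0 st); rewrite mem_head.
rewrite -(homotopy_poly1 A k); apply: count_roots_le_limit => //.
  by rewrite homotopy_poly1.
by move=> tau tau01; rewrite count_roots_le_before.
Qed.

End Middle.

Lemma pellet_lowest : (0 < n)%N -> \det (A ord0) != 0 ->
  exists t0, positive_roots (pellet_poly A ord0) [:: t0] /\
    forall z, normc z < t0 -> ~~ root (det_poly A) z.
Proof.
move=> n0 dA; pose q := pellet_poly A ord0.
have q0 : q`_0 = 1 by have := coef_pellet_poly A ord0 ord0; rewrite eqxx.
have [t [r [t0 qE r0]]] : exists t r,
    [/\ 0 < t, q = (t%:P - 'X) * r & forall x, 0 < x -> 0 < r.[x]].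
  apply: (@one_sign_change _ q 1).
  - by case=> // _; rewrite q0 ler01.
  - by move=> i i0; apply: coef_pellet_poly_le0; rewrite -lt0n.
  - by rewrite q0 ltr01.
  exists n; have := coef_pellet_poly A ord0 ord_max; rewrite -val_eqE /= gtn_eqF// => ->.
  by rewrite oppr_lt0 pellet_coef_gt0.
exists t; split; first exact: positive_roots1 t0 qE r0.
move=> z zt; apply: (det_poly_nonroot dA); rewrite -/q.
have := normc_ge0 z; rewrite le_eqVlt => /orP[/eqP <-|z0].
  by rewrite horner_coef0 q0 ltr01.
rewrite qE hornerM hornerD hornerN hornerC hornerX.
by rewrite mulr_gt0 ?r0// subr_gt0.
Qed.

Lemma pellet_highest : (0 < n)%N -> \det (A ord_max) != 0 ->
  exists sn, positive_roots (pellet_poly A ord_max) [:: sn] /\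
    forall z, sn < normc z -> ~~ root (det_poly A) z.
Proof.
move=> n0 dA; pose q := pellet_poly A ord_max.
have [t [r [t0 qE r0]]] : exists t r,
    [/\ 0 < t, - q = (t%:P - 'X) * r & forall x, 0 < x -> 0 < r.[x]].
  apply: (@one_sign_change _ (- q) n).
  - by move=> i i_n; rewrite coefN oppr_ge0 coef_pellet_poly_le0//= ltn_eqF.
  - move=> i; rewrite leq_eqVlt coefN oppr_le0 => /orP[/eqP <-|ni].
      by have := coef_pellet_poly A ord_max ord_max; rewrite eqxx /= => ->; rewrite ler01.
    by rewrite nth_default// (leq_trans (size_pellet_poly A ord_max)).
  - have := coef_pellet_poly A ord_max ord0; rewrite -val_eqE /= ltn_eqF// coefN => ->.
    by rewrite opprK pellet_coef_gt0.
  exists n; have := coef_pellet_poly A ord_max ord_max; rewrite eqxx /= coefN => ->.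
  by rewrite oppr_lt0 ltr01.
exists t; split.
  have [lpos lP] := positive_roots1 t0 qE r0; split=> // x x0.
  rewrite lP// -[RHS](@mupMr _ _ (- 1)%:P) ?rootC ?oppr_eq0 ?oner_eq0//.
  by rewrite polyCN mulN1r.
move=> z tz; apply: (det_poly_nonroot dA); rewrite -/q.
have z0 := lt_trans t0 tz.
rewrite -[q]opprK qE hornerN hornerM hornerD hornerN hornerC hornerX.
by rewrite -mulNr opprB mulr_gt0 ?r0// subr_gt0.
Qed.

End Pellet.

Theorem theorem2p1 (R : realType) (m n : nat) (n_gt0 : (0 < n)%N)
    (A : 'I_n.+1 -> 'M[R[i]]_m) (PA : matrix_poly_class A) :
  [/\ (forall k : 'I_n.+1, (0 < k < n)%N -> \det (A k) != 0 ->
         positive_roots (pellet_poly A k) [::] \/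
         exists s t : R,
           s <= t /\ positive_roots (pellet_poly A k) [:: s; t]),
      (forall k : 'I_n.+1, (0 < k < n)%N -> \det (A k) != 0 ->
         forall s t : R,
           s <= t -> positive_roots (pellet_poly A k) [:: s; t] ->
         [/\ (forall x : R[i], s < normc x < t -> ~~ root (det_poly A) x),
             (m * k <= count_roots_le (det_poly A) s)%N &
             (s < t -> count_roots_le (det_poly A) s = (m * k)%N)]),
      (\det (A ord0) != 0 ->
         exists t0 : R, positive_roots (pellet_poly A ord0) [:: t0] /\
           forall x : R[i], normc x < t0 -> ~~ root (det_poly A) x) &
      (\det (A ord_max) != 0 ->
         exists sn : R, positive_roots (pellet_poly A ord_max) [:: sn] /\
           forall x : R[i], sn < normc x -> ~~ root (det_poly A) x)].
Proof.
have [pA An A0] := PA; split.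
- by move=> k k_mid Ak; apply: pellet_poly_positive_roots.
- move=> k k_mid Ak s t _ st; split.
  + by move=> z; apply: (det_poly_nonroot_annulus A0 An k_mid Ak st).
  + exact: (count_roots_le_ge A0 An k_mid Ak pA st).
  + exact: (count_roots_le_strict A0 An k_mid Ak st).
- exact: pellet_lowest.
- exact: pellet_highest.
Qed.
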